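(* Let $G$ and $H$ be two connected graphs of orders $n,m\in\mathbb{N}$. Then $\gamma_{sp}(G\star H)\leq n(\gamma_{sp}(H)+1)$.
   Context: All graphs are finite, simple, undirected. For $S\subseteq V(G)$, $\overline{S}=V(G)\setminus S$ and $N(v)$ denotes the open neighbourhood of $v$. A set $S$ is a super dominating set of $G$ if every vertex of $\overline{S}$ has a neighbour in $S$ and for every $u\in\overline{S}$ there is $v\in S$ with $N(v)\cap\overline{S}=\{u\}$. The super domination number $\gamma_{sp}(G)$ is the minimum cardinality of a super dominating set of $G$. The neighbourhood corona product $G\star H$ is the graph obtained by taking one copy of $G$ and $|V(G)|$ disjoint copies of $H$, one copy $H_w$ for each vertex $w$ of $G$, and joining every neighbour (in $G$) of $w$ to every vertex of $H_w$, for each $w\in V(G)$. *)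

(* Defs.v *)
From HB Require Import structures.
From mathcomp Require Import all_boot.

Set Implicit Arguments.
Unset Strict Implicit.
Unset Printing Implicit Defensive.

Record sgraph := SGraph {
  vertex :> finType;
  edge : rel vertex;
  edge_sym : symmetric edge;
  edge_irrefl : irreflexive edge
}.

Definition nbhd (G : sgraph) (v : G) : {set G} := [set u | edge v u].

(* The graph without vertices is not considered connected. *)
Definition connected_graph (G : sgraph) : Prop :=
  0 < #|G| /\ forall x y : G, connect (@edge G) x y.

Definition super_dominating (G : sgraph) (S : {set G}) : bool :=
  [forall u in ~: S, exists v in S, edge u v] &&
  [forall u in ~: S, exists v in S, nbhd v :&: ~: S == [set u]].

Lemma super_dominating_setT (G : sgraph) : super_dominating [set: G].
Proof.
by apply/andP; split; apply/forall_inP => u; rewrite setCT inE.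
Qed.

(* [arg min] needs a witness of the predicate in order to be a minimiser:
   this is super_dominating_setT. *)
Definition gamma_sp (G : sgraph) : nat :=
  #|[arg min_(S < [set: G] | super_dominating S) #|S|]|.

Lemma gamma_spP (G : sgraph) :
  (exists2 S : {set G}, super_dominating S & #|S| = gamma_sp G) /\
  (forall S : {set G}, super_dominating S -> gamma_sp G <= #|S|).
Proof.
rewrite /gamma_sp; case: arg_minnP; first exact: super_dominating_setT.
by move=> S sdS minS; split; [exists S | exact: minS].
Qed.

Section NeighbourhoodCorona.

Variables G H : sgraph.

(* inl x is the vertex x of G; inr (w, h) is the vertex h of the copy H_w. *)
Definition ncorona_edge : rel (G + G * H) := fun a b =>
  match a, b with
  | inl x, inl y => edge x y
  | inl x, inr (w, _) => edge w x
  | inr (w, _), inl x => edge w x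
  | inr (w, h), inr (w', h') => (w == w') && edge h h'
  end.

Lemma ncorona_edge_sym : symmetric ncorona_edge.
Proof.
move=> [x|[w h]] [y|[w' h']] //=; first exact: edge_sym.
by rewrite eq_sym edge_sym.
Qed.

Lemma ncorona_edge_irrefl : irreflexive ncorona_edge.
Proof. by move=> [x|[w h]] /=; rewrite edge_irrefl ?andbF. Qed.

Definition ncorona : sgraph := SGraph ncorona_edge_sym ncorona_edge_irrefl.

End NeighbourhoodCorona.

(* Main.v *)
Require Import Defs.
From mathcomp Require Import all_boot.

(** Take a minimum super dominating set S of H. All of V(G), with a copy of S in each H_w, has n +
    n|S| vertices ([card_ncorona_lift]) and is super dominating ([super_dominating_ncorona_lift]):
    any vertex left out lies in some H_w, where the copy of S serves it as S does in H. *)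

Definition ncorona_lift (G H : sgraph) (S : {set H}) : {set ncorona G H} :=
  [set a : G + G * H | if a is inr (_, h) then h \in S else true].

Lemma card_ncorona_lift (G H : sgraph) (S : {set H}) :
  #|ncorona_lift G H S| = #|G| * (#|S| + 1).
Proof.
have -> : ncorona_lift G H S =
    (inl @: [set: G]) :|: (inr @: setX [set: G] S) :> {set G + G * H}.
  apply/setP => -[x|[w h]]; rewrite !inE.
    by rewrite imset_f ?inE.
  rewrite (mem_imset (f := inr)); last by move=> ? ? [].
  rewrite !inE /=.
  by case: imsetP => // -[].
rewrite cardsU (_ : _ :&: _ = set0) ?cards0 ?subn0; last first.
  apply/setP => a; rewrite !inE; apply/negP => /andP[/imsetP[x _ ->]].
  by case/imsetP.
rewrite !card_imset; try by move=> ? ? [].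
by rewrite cardsX cardsT mulnDr muln1 addnC.
Qed.

(* As every vertex of G lies in the lift of S, the private neighbours of a
   copy H_w relative to the lift are those of H relative to S. *)
Lemma super_dominating_ncorona_lift (G H : sgraph) (S : {set H}) :
  super_dominating S -> super_dominating (ncorona_lift G H S).
Proof.
case/andP=> /forall_inP domS /forall_inP privS.
apply/andP; split; apply/forall_inP => -[x|[w h]]; rewrite !inE // => hS.
  have /exists_inP[v vS hv] := domS h ltac:(by rewrite inE).
  by apply/exists_inP; exists (inr (w, v)); rewrite ?inE //= eqxx.
have /exists_inP[v vS /eqP privv] := privS h ltac:(by rewrite inE).
apply/exists_inP; exists (inr (w, v)); first by rewrite inE.
apply/eqP/setP => -[x|[w' h']]; rewrite !inE /= ?andbF //.
(* Only vertices of copies remain: the factor [w == w'] of adjacency confines the neighbours to H_w,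
   and [privv] singles out [h] there. *)
move/setP/(_ h'): privv; rewrite !inE => eqh'.
by rewrite -andbA eqh' eq_sym.
Qed.

Theorem theorem3p2 (G H : sgraph) (n m : nat)
    (Gn : #|G| = n) (Hm : #|H| = m)
    (Gconn : connected_graph G) (Hconn : connected_graph H) :
  gamma_sp (ncorona G H) <= n * (gamma_sp H + 1).
Proof.
have [[S sdS <-] _] := gamma_spP H.
rewrite -Gn -card_ncorona_lift.
exact: (gamma_spP _).2 _ (super_dominating_ncorona_lift _ _ _ sdS).
Qed.
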